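(* Let $(\bar x,\bar\lambda)=(\bar x^1,\dots,\bar x^N,\bar\lambda^1,\dots,\bar\lambda^N)\in S_{\rm KKT}(\bar p)$, $\bar p=(\bar u,\bar v,\bar w)$. The following are equivalent: (i) $S_{\rm KKT}$ has a Lipschitz continuous single-valued localization around $\bar p$ for $(\bar x,\bar\lambda)$; (ii) $T_{\rm KKT}$ has a Lipschitz continuous single-valued localization around $(\bar u,\bar v)$ for $(\bar x,\bar\lambda)$.
   Context: Nash equilibrium problem (NEP) with canonical perturbations. There are $N$ players; player $k$ has strategy $x^k\in\mathbb R^{n_k}$; $x=(x^1,\dots,x^N)\in\mathbb R^n$, $n=n_1+\cdots+n_N$; $x^{-k}$ denotes the other players' strategies. Parameters: $p^k=(u^k,v^k,w^k)\in\mathbb R^{m_k}\times\mathbb R^{n_k}\times\mathbb R^{d_k}$, $p=(p^1,\dots,p^N)$, identified with $(u,v,w)\in\mathbb R^{m}\times\mathbb R^n\times\mathbb R^d$, $m=\sum m_k$, $d=\sum d_k$. Given $x^{-k},p^k$, player $k$ solves $$\min_{x^k}\ f^k(x^k,x^{-k};w^k)-\langle v^k,x^k\rangle\ \text{ s.t. } g^k_i(x^k;w^k)=u^k_i\ (i=1,\dots,s_k),\ \ g^k_j(x^k;w^k)\le u^k_j\ (j=s_k+1,\dots,m_k),$$ with $f^k\in C^2(\mathbb R^n\times\mathbb R^{d_k})$, $g^k_i\in C^2(\mathbb R^{n_k}\times\mathbb R^{d_k})$. Lagrangian: $L^k(x^k,x^{-k},\lambda^k;w^k)=f^k(x^k,x^{-k};w^k)+\sum_{i=1}^{m_k}\lambda^k_ig^k_i(x^k;w^k)$.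 KKT mapping: $S_{\rm KKT}(p)$ is the set of $(x,\lambda)\in\mathbb R^n\times\mathbb R^m$ such that for each $k$: $v^k=\nabla_{x^k}L^k(x^k,x^{-k},\lambda^k;w^k)$; $g^k_i(x^k;w^k)=u^k_i$ for $i\le s_k$; and $\lambda^k_j\ge0$, $g^k_j(x^k;w^k)\le u^k_j$, $\lambda^k_j(g^k_j(x^k;w^k)-u^k_j)=0$ for $j>s_k$. The KKT mapping with only tilt perturbations is $T_{\rm KKT}(u,v):=S_{\rm KKT}(u,v,\bar w)$, with $\bar w$ the $w$-component of $\bar p$. A set-valued mapping $\Phi$ has a Lipschitz continuous single-valued localization around $\bar a$ for $\bar b$ if $\bar b\in\Phi(\bar a)$ and there are neighborhoods $U$ of $\bar a$, $V$ of $\bar b$ such that ${\rm gph}\,\Phi\cap(U\times V)$ is the graph of a Lipschitz continuous single-valued mapping $U\to V$. *)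

(* Defs.v *)
From mathcomp Require Export all_boot all_order all_algebra.
From mathcomp Require Export classical_sets functions reals topology normedtype
  derive.

Set Implicit Arguments.
Unset Strict Implicit.
Unset Printing Implicit Defensive.

Import GRing.Theory Num.Theory numFieldNormedType.Exports.
Local Open Scope classical_set_scope.
Local Open Scope ring_scope.

(* For finite-dimensional [V], the only case used below, this is the usual
   class C^r: continuity of all the directional derivatives amounts to
   continuity of the derivative. *)
Fixpoint Cr (R : realType) (V : normedModType R) (r : nat) (f : V -> R) : Prop :=
  match r with
  | 0 => continuous f
  | r'.+1 => (forall x, differentiable f x) /\ (forall v, Cr r' ('D_v f))
  end.

Definition gradient (R : realType) (n : nat) (f : 'rV[R]_n -> R) (x : 'rV[R]_n) :
    'rV[R]_n :=
  \row_(j < n) 'D_(delta_mx 0 j) f x.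

(* R^(n_1 + ... + n_N); the block [x^k] of [x] is [submxrow x k]. *)
Notation blockvec R n := 'rV[R]_(\sum_k n k).

(* The vector (y, x^{-k}): [y] in block [k], the blocks of [x] elsewhere. *)
Definition setblock (R : realType) (N : nat) (n : 'I_N -> nat)
    (x : blockvec R n) (k : 'I_N) (y : 'rV[R]_(n k)) : blockvec R n :=
  \mxrow_j dfwith (fun i => submxrow x i) y j.

Arguments setblock {R N n} x k y.

(* Under the canonical perturbation (u, v, w), player k minimizes
     objective k (x, w^k) - <v^k, x^k>   over x^k
   subject to constraint k i (x^k, w^k) = u^k_i for i < eqdim k, and
   constraint k i (x^k, w^k) <= u^k_i for eqdim k <= i < cdim k. *)
Record nep (R : realType) := Nep {
  players : nat;
  xdim : 'I_players -> nat;
  cdim : 'I_players -> nat;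
  wdim : 'I_players -> nat;
  eqdim : 'I_players -> nat;
  objective : forall k, blockvec R xdim * 'rV[R]_(wdim k) -> R;
  constraint : forall k, 'I_(cdim k) -> 'rV[R]_(xdim k) * 'rV[R]_(wdim k) -> R;
  eqdim_le : forall k, (eqdim k <= cdim k)%N;
  objective_C2 : forall k, Cr 2 (@objective k);
  constraint_C2 : forall k i, Cr 2 (@constraint k i)
}.

Arguments xdim {R} P k : rename.
Arguments cdim {R} P k : rename.
Arguments wdim {R} P k : rename.
Arguments eqdim {R} P k : rename.
Arguments objective {R} P k : rename.
Arguments constraint {R} P k i : rename.

Section KKT.
Variables (R : realType) (P : nep R).

Definition Lagrangian (k : 'I_(players P)) (x : blockvec R (xdim P))
    (lam : 'rV[R]_(cdim P k)) (w : 'rV[R]_(wdim P k)) : R :=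
  objective P k (x, w)
  + \sum_(i < cdim P k) lam 0 i * constraint P k i (submxrow x k, w).

Definition S_KKT
    (p : blockvec R (cdim P) * blockvec R (xdim P) * blockvec R (wdim P)) :
    set (blockvec R (xdim P) * blockvec R (cdim P)) :=
  let: (u, v, w) := p in
  [set z | let: (x, lam) := z in
    forall k : 'I_(players P),
      let xk := submxrow x k in let lamk := submxrow lam k in
      let uk := submxrow u k in let vk := submxrow v k in
      let wk := submxrow w k in
      [/\ vk = gradient (fun y => Lagrangian (setblock x k y) lamk wk) xk,
          forall i : 'I_(cdim P k), (i < eqdim P k)%N ->
            constraint P k i (xk, wk) = uk 0 i
        & forall j : 'I_(cdim P k), (eqdim P k <= j)%N ->
            [/\ 0 <= lamk 0 j, constraint P k j (xk, wk) <= uk 0 j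
              & lamk 0 j * (constraint P k j (xk, wk) - uk 0 j) = 0]]].

Definition T_KKT (wbar : blockvec R (wdim P))
    (q : blockvec R (cdim P) * blockvec R (xdim P)) :
    set (blockvec R (xdim P) * blockvec R (cdim P)) :=
  let: (u, v) := q in S_KKT (u, v, wbar).

End KKT.

Arguments S_KKT {R} P p.
Arguments T_KKT {R} P wbar q.

(* Only the values of [phi] on [U] matter. *)
Definition lipschitz_localization (R : realType) (A B : normedModType R)
    (Phi : A -> set B) (a : A) (b : B) : Prop :=
  Phi a b /\
  exists (U : set A) (V : set B) (phi : A -> B),
    [/\ nbhs a U, nbhs b V, set_fun U V phi, [lipschitz phi y | y in U]
      & [set z | Phi z.1 z.2] `&` (U `*` V) = [set z | U z.1 /\ z.2 = phi z.1]].

(* Main.v *)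
(* Write F(z, w) = (g(x; w), grad_x L(x, lambda; w)) for z = (x, lambda). A point z
   solves the KKT system for (u, v, w) iff it solves the KKT system for
   ((u, v) + F(z, wbar) - F(z, w), wbar). If phi is a Lipschitz localization of
   T_KKT, the solutions for (u, v, w) near (xbar, lambar) are thus the fixed points
   of z |-> phi((u, v) + F(z, wbar) - F(z, w)). Since F is strictly differentiable,
   the Lipschitz constant in z of F(z, wbar) - F(z, w) is arbitrarily small near the
   reference point, so this map is a contraction of a small closed ball, and its
   fixed point depends on (u, v, w) in a Lipschitz way. *)
Require Import Defs.
From HB Require Import structures.
From mathcomp Require Import boolp filter complete_normed_module sequences.
From mathcomp Require Import interval_inference prodnormedzmodule ring lra.

Set Implicit Arguments.
Unset Strict Implicit.
Unset Printing Implicit Defensive.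

Import Order.TTheory GRing.Theory Num.Theory numFieldNormedType.Exports.
Local Open Scope classical_set_scope.
Local Open Scope ring_scope.

(** * Completeness of products of complete normed modules *)

HB.instance Definition _ (R : realType) (U V : completeNormedModType R) :=
  Pointed.on (U * V)%type.

(** Both projections of a Cauchy filter are Cauchy, and their limits pair up. This makes the space
    of pairs $(x, \lambda)$ complete, as the Banach fixed point theorem requires. *)
Lemma prod_cauchy_cvg (R : realType) (U V : completeNormedModType R)
    (F : set_system (U * V)) : ProperFilter F -> cauchy F -> cvg F.
Proof.
move=> FF /cauchy_ballP Fc.
have proj_cauchy (T : completeNormedModType R) (p : U * V -> T) :
    (forall e x y, ball x e y -> ball (p x) e (p y)) -> cauchy (p @ F).
  move=> pball; apply/cauchy_ballP => e e0.
  have [[A B]/= [FA FB] AB] := Fc e e0.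
  exists (p @` A, p @` B) => /=.
    by split; [apply: filterS FA|apply: filterS FB] => x ?; exists x.
  by move=> [_ _]/= [[x Ax <-] [y By <-]]; apply: pball; apply: (AB (x, y)).
have /cauchy_cvg c1 : cauchy (fst @ F) by apply: proj_cauchy => e x y [].
have /cauchy_cvg c2 : cauchy (snd @ F) by apply: proj_cauchy => e x y [].
apply/cvg_ex; exists (lim (fst @ F), lim (snd @ F)).
rewrite [X in X --> _](_ : F = (x.1, x.2) @[x --> F]); last first.
  by apply/funext => A; rewrite /fmap/=; congr F; apply/funext => -[].
exact: cvg_pair.
Qed.

HB.instance Definition _ (R : realType) (U V : completeNormedModType R) :=
  Uniform_isComplete.Build (U * V)%type (@prod_cauchy_cvg R U V).

HB.instance Definition _ (R : realType) (n : nat) := Complete.on 'rV[R]_n.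

(** * Strict differentiability and its calculus rules *)

Section StrictDifferentiability.
Variable R : realType.

(** The derivative [l] is a bare function, so that explicit formulas and [choice] can supply it; the
    bound by [K] is its continuity. *)
Definition strictly_differentiable (V W : normedModType R) (f : V -> W) (a : V) :=
  exists l : V -> W, [/\ linear l, exists K, forall v, `|l v| <= K * `|v|
    & forall e, 0 < e ->
        \forall y & z \near a, `|f y - f z - l (y - z)| <= e * `|y - z|].

Implicit Types V W : normedModType R.

Lemma near2_ball V (a : V) (P : set (V * V)) :
  filter_prod (nbhs a) (nbhs a) P ->
  exists2 r, 0 < r & forall y z, `|a - y| < r -> `|a - z| < r -> P (y, z).
Proof.
case=> -[A B]/= [/nbhs_normP[r /= r0 rA] /nbhs_normP[s /= s0 sB]] ABP.
exists (Num.min r s); first by rewrite lt_min r0.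
move=> y z; rewrite !lt_min => /andP[yr _] /andP[_ zs].
by apply: (ABP (y, z)); split; [apply: rA|apply: sB].
Qed.

Lemma strictly_differentiable_lipschitz V W (f : V -> W) a :
  strictly_differentiable f a ->
  exists2 K, 0 < K & \forall y & z \near a, `|f y - f z| <= K * `|y - z|.
Proof.
move=> [l [_ [K lK] fl]]; exists (`|K| + 1); first by rewrite ltr_wpDl.
apply: filterS (fl 1 ltr01) => -[y z]/= yz.
rewrite -[f y - f z](subrK (l (y - z))) (le_trans (ler_normD _ _))//.
rewrite mulrDl addrC lerD// (le_trans (lK _))//.
by rewrite ler_wpM2r// ler_norm.
Qed.

Lemma strictly_differentiable_cvg V W (f : V -> W) a :
  strictly_differentiable f a -> f x @[x --> a] --> f a.
Proof.
move=> /strictly_differentiable_lipschitz[K K0 /near2_ball[r r0 fr]].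
apply/cvgrPdist_lt => e e0.
near=> x.
have ax : `|a - x| < r by near: x; apply/nbhs_normP; exists r.
rewrite (le_lt_trans (fr _ _ _ ax)) ?subrr ?normr0// -ltr_pdivlMl//.
near: x; apply/nbhs_normP; exists (K^-1 * e) => //.
by rewrite /= mulr_gt0// invr_gt0.
Unshelve. all: by end_near. Qed.

Lemma strictly_differentiable_linear V W (f : V -> W) a :
  linear f -> (exists K, forall v, `|f v| <= K * `|v|) ->
  strictly_differentiable f a.
Proof.
move=> lf bf; exists f; split=> // e e0.
pose F := HB.pack_for {linear V -> W} f (GRing.isLinear.Build _ _ _ _ f lf).
near=> y z => /=.
by rewrite -[f]/(F : V -> W) linearB subrr normr0 mulr_ge0// ltW.
Unshelve. all: by end_near. Qed.

Lemma strictly_differentiable_comp V V' W (f : V' -> W) (g : V -> V') a :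
  strictly_differentiable f (g a) -> strictly_differentiable g a ->
  strictly_differentiable (f \o g) a.
Proof.
move=> [l [ll [K lK] fl]] sg.
have [M M0 gM] := strictly_differentiable_lipschitz sg.
have /cvgrPdist_lt ga := strictly_differentiable_cvg sg.
move: sg => [m [lm [K' mK'] gm]].
pose L := HB.pack_for {linear V' -> W} l (GRing.isLinear.Build _ _ _ _ l ll).
have lB u v : l (u - v) = l u - l v by exact: (linearB L).
(* [K] may be zero or negative; [|K| + 1] is a positive bound that can be multiplied through and
   divided by. *)
have {}lK v : `|l v| <= (`|K| + 1) * `|v|.
  by rewrite (le_trans (lK v))// ler_wpM2r// (le_trans (ler_norm K))// lerDl.
have K0 : 0 < `|K| + 1 by rewrite ltr_wpDl.
exists (l \o m); split.
- by move=> k u v; rewrite /= lm ll.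
- exists ((`|K| + 1) * K') => v /=.
  by rewrite (le_trans (lK _))// -mulrA ler_pM2l.
- move=> e e0.
  (* The error splits into the remainder of [f], at most [c * M], and the image under [l] of the
     remainder of [g], at most [(|K| + 1) * c], both relative to the increment; [c] makes them add
     up to [e]. *)
  pose c := e / (M + (`|K| + 1)).
  have c0 : 0 < c by rewrite divr_gt0// addr_gt0.
  have [r r0 fr] := near2_ball (fl c c0).
  near=> p.
  have gr1 : `|g a - g p.1| < r by near: p; exact: cvg_fst (ga _ r0).
  have gr2 : `|g a - g p.2| < r by near: p; exact: cvg_snd (ga _ r0).
  have gMp : `|g p.1 - g p.2| <= M * `|p.1 - p.2| by near: p; exact: gM.
  have gmp : `|g p.1 - g p.2 - m (p.1 - p.2)| <= c * `|p.1 - p.2|.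
    by near: p; exact: gm.
  have -> : e = c * M + (`|K| + 1) * c.
    by rewrite (mulrC (_ + 1)) -mulrDr divfK// gt_eqF// addr_gt0.
  rewrite [X in `|X|](_ : _ =
      (f (g p.1) - f (g p.2) - l (g p.1 - g p.2))
      + l (g p.1 - g p.2 - m (p.1 - p.2))); last first.
    by rewrite /= (lB (g p.1 - g p.2)) addrA subrK.
  rewrite mulrDl (le_trans (ler_normD _ _))// lerD//.
    by rewrite (le_trans (fr _ _ gr1 gr2))// -mulrA ler_pM2l.
  by rewrite (le_trans (lK _))// -mulrA ler_pM2l.
Unshelve. all: by end_near. Qed.

Lemma strictly_differentiableD V W (f g : V -> W) a :
  strictly_differentiable f a -> strictly_differentiable g a ->
  strictly_differentiable (f \+ g) a.
Proof.
move=> [l [ll [K lK] fl]] [m [lm [M mM] gm]].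
exists (l \+ m); split.
- by move=> k u v; rewrite /= ll lm scalerDr addrACA.
- exists (K + M) => v; rewrite /= mulrDl (le_trans (ler_normD _ _))//.
  exact: lerD.
- move=> e e0; have e20 : 0 < e / 2 by rewrite divr_gt0.
  apply: filterS2 (fl _ e20) (gm _ e20) => -[y z]/= fyz gyz.
  rewrite (_ : _ - _ = (f y - f z - l (y - z)) + (g y - g z - m (y - z))).
    by rewrite [e]splitr mulrDl (le_trans (ler_normD _ _))// lerD.
  by rewrite /= !opprD [RHS]addrACA (addrACA (f y)).
Qed.

Lemma strictly_differentiable_sum V W n (f : 'I_n -> V -> W) a :
  (forall i, strictly_differentiable (f i) a) ->
  strictly_differentiable (fun x => \sum_i f i x) a.
Proof.
elim: n f => [|n IH] f fa.
  under eq_fun do rewrite big_ord0.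
  exists (fun=> 0); split.
  - by move=> k u v; rewrite scaler0 addr0.
  - by exists 0 => v; rewrite normr0 mul0r.
  - move=> e e0; near=> y z => /=.
    by rewrite !subr0 normr0 mulr_ge0// ltW.
under eq_fun do rewrite big_ord_recl.
by apply: strictly_differentiableD (fa ord0) (IH _ _) => i.
Unshelve. all: by end_near. Qed.

Lemma strictly_differentiableM V (f g : V -> R) a :
  strictly_differentiable f a -> strictly_differentiable g a ->
  strictly_differentiable (f \* g) a.
Proof.
move=> sf sg.
have [L L0 fL] := strictly_differentiable_lipschitz sf.
have [L' L'0 gL] := strictly_differentiable_lipschitz sg.
have /cvgrPdist_lt fa := strictly_differentiable_cvg sf.
have /cvgrPdist_lt ga := strictly_differentiable_cvg sg.
move: sf sg => [l [ll [K lK] fl]] [m [lm [M mM] gm]].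
exists (fun v => f a * m v + g a * l v); split.
- by move=> k u v; rewrite ll lm /GRing.scale/=; lra.
- exists (`|f a| * M + `|g a| * K) => v.
  rewrite (le_trans (ler_normD _ _))// !normrM mulrDl -!mulrA lerD//.
    by rewrite ler_wpM2l.
  by rewrite ler_wpM2l.
- move=> e e0.
  have D0 : 0 < L + L' + `|f a| + `|g a| by rewrite ltr_wpDr// ltr_wpDr// addr_gt0.
  pose c := e / (L + L' + `|f a| + `|g a|).
  have c0 : 0 < c by rewrite divr_gt0.
  near=> p.
  have fp : `|f a - f p.1| < c by near: p; exact: cvg_fst (fa _ c0).
  have gp : `|g a - g p.2| < c by near: p; exact: cvg_snd (ga _ c0).
  have fLp : `|f p.1 - f p.2| <= L * `|p.1 - p.2| by near: p; exact: fL.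
  have gLp : `|g p.1 - g p.2| <= L' * `|p.1 - p.2| by near: p; exact: gL.
  have flp : `|f p.1 - f p.2 - l (p.1 - p.2)| <= c * `|p.1 - p.2|.
    by near: p; exact: fl.
  have gmp : `|g p.1 - g p.2 - m (p.1 - p.2)| <= c * `|p.1 - p.2|.
    by near: p; exact: gm.
  (* The first two terms pair a Lipschitz increment with a factor that is small near [a]; the last
     two are the remainders of [g] and [f]. Each contributes one summand of the denominator of
     [c]. *)
  rewrite [X in `|X|](_ : _ =
      (g p.2 - g a) * (f p.1 - f p.2) + (f p.1 - f a) * (g p.1 - g p.2)
      + f a * (g p.1 - g p.2 - m (p.1 - p.2))
      + g a * (f p.1 - f p.2 - l (p.1 - p.2))); last by rewrite /=; ring.
  have -> : e = c * L + c * L' + `|f a| * c + `|g a| * c.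
    by rewrite (mulrC `|f a|) (mulrC `|g a|) -!mulrDr divfK// gt_eqF.
  rewrite [leRHS]mulrDl (le_trans (ler_normD _ _))// lerD//; last first.
    by rewrite normrM -mulrA ler_wpM2l.
  rewrite [leRHS]mulrDl (le_trans (ler_normD _ _))// lerD//; last first.
    by rewrite normrM -mulrA ler_wpM2l.
  rewrite [leRHS]mulrDl (le_trans (ler_normD _ _))// lerD// normrM -mulrA ler_pM//.
    by rewrite distrC ltW.
  by rewrite distrC ltW.
Unshelve. all: by end_near. Qed.

Lemma rV_norm_le n (v : 'rV[R]_n) c :
  0 <= c -> (forall j, `|v 0 j| <= c) -> `|v| <= c.
Proof.
move=> c0 vc; rewrite [leLHS]/Num.Def.normr/= mx_normrE bigmax_le// => -[i j] _ /=.
by rewrite (ord1 i).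
Qed.

Lemma le_rV_norm n (v : 'rV[R]_n) j : `|v 0 j| <= `|v|.
Proof.
rewrite [leRHS]/Num.Def.normr/= mx_normrE.
by apply/bigmax_geP; right => /=; exists (0, j).
Qed.

Lemma strictly_differentiable_row V n (f : V -> 'rV[R]_n) a :
  (forall j, strictly_differentiable (fun x => f x 0 j) a) ->
  strictly_differentiable f a.
Proof.
move=> /choice[l fl]; exists (fun v => \row_j l j v); split.
- move=> k u v; apply/rowP => j; rewrite !mxE.
  by have [-> _ _] := fl j.
- have /choice[K lK] : forall j, exists K, forall v, `|l j v| <= K * `|v|.
    by move=> j; have [_ ? _] := fl j.
  exists (\sum_j `|K j|) => v; apply: rV_norm_le => [|j].
    by rewrite mulr_ge0// sumr_ge0.
  rewrite mxE (le_trans (lK _ _))// ler_wpM2r//.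
  by rewrite (le_trans (ler_norm _))// (bigD1 j)//= lerDl sumr_ge0.
- move=> e e0.
  have : \forall p \near (nbhs a, nbhs a), forall j,
      `|f p.1 0 j - f p.2 0 j - l j (p.1 - p.2)| <= e * `|p.1 - p.2|.
    apply: (@filter_forall _ _ (fun j p => is_true (_ <= _))
      (filter_prod (nbhs a) (nbhs a))) => j.
    by have [_ _ flj] := fl j; exact: flj.
  apply: filterS => -[y z]/= fyz; apply: rV_norm_le => [|j].
    by rewrite mulr_ge0// ltW.
  by rewrite !mxE.
Qed.

Lemma strictly_differentiable_pair V W W' (f : V -> W) (g : V -> W') a :
  strictly_differentiable f a -> strictly_differentiable g a ->
  strictly_differentiable (fun x => (f x, g x)) a.
Proof.
move=> [l [ll [K lK] fl]] [m [lm [M mM] gm]].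
exists (fun v => (l v, m v)); split.
- by move=> k u v; rewrite ll lm.
- exists (Num.max K M) => v; rewrite prod_normE ge_max/=.
  rewrite (le_trans (lK v)) ?(le_trans (mM v))// ler_wpM2r//.
    by rewrite le_max lexx orbT.
  by rewrite le_max lexx.
- move=> e e0.
  apply: filterS2 (fl _ e0) (gm _ e0) => -[y z]/= fyz gyz.
  by rewrite prod_normE ge_max fyz.
Qed.

End StrictDifferentiability.

(** * Directional derivatives along affine substitutions *)

Section AffineComposition.
Variables (R : realType) (U V W : normedModType R).
Variables (f : V -> W) (A : U -> V) (x v : U) (v' : V).
Hypothesis Axv : forall h : R, A (h *: v + x) = h *: v' + A x.

Let quotientE : (fun h => h^-1 *: ((f \o A \o shift x) (h *: v) - (f \o A) x)) =
  (fun h => h^-1 *: ((f \o shift (A x)) (h *: v') - f (A x))).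
Proof. by apply/funext => h /=; rewrite Axv. Qed.

(** The two difference quotients are the same function of [h], so derivability and derivative carry
    over without the chain rule. *)
Lemma derivable_comp_affine : derivable f (A x) v' -> derivable (f \o A) x v.
Proof. by rewrite /derivable quotientE. Qed.

Lemma derive_comp_affine : 'D_v (f \o A) x = 'D_v' f (A x).
Proof. by rewrite /derive quotientE. Qed.

End AffineComposition.

(** * Continuously differentiable functions are strictly differentiable *)

Section C1.
Variables (R : realType) (V : normedModType R) (f : V -> R).
Hypothesis df : forall x, differentiable f x.

(** The scalar mean value theorem on $[0,1]$, applied to [f] along the segment from [z] to [y]. *)
Lemma mean_value_segment (y z : V) :
  exists2 t : R, 0 <= t <= 1 & f y - f z = 'D_(y - z) f (t *: (y - z) + z).
Proof.
pose A (t : R) := t *: (y - z) + z.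
have Aaff (t h : R) : A (h *: 1 + t) = h *: (y - z) + A t.
  by rewrite /A scalerDl /GRing.scale/= mulr1 addrA.
have dfA (t : R) : is_derive t 1 (f \o A) ('D_(y - z) f (A t)).
  apply: DeriveDef; last exact: derive_comp_affine.
  by apply: derivable_comp_affine => //; apply: diff_derivable.
have [|t t01] := @MVT_segment R (f \o A) _ 0 1 ler01 (fun t _ => dfA t).
  apply: continuous_subspaceT => t; apply: differentiable_continuous.
  by apply/derivable1_diffP; have [] := dfA t.
rewrite subr0 mulr1 /= /A scale1r subrK scale0r add0r => ->.
by exists t.
Qed.

(* Finite dimension of [V] is encoded by a finite spanning family [e] with bounded
   coordinate functions [c]. *)
Lemma C1_strictly_differentiable (I : finType) (e : I -> V) (c : I -> V -> R)
    (K : R) (a : V) :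
  (forall v, v = \sum_i c i v *: e i) -> (forall i v, `|c i v| <= K * `|v|) ->
  (forall v, {for a, continuous ('D_v f)}) -> strictly_differentiable f a.
Proof.
move=> ev cK cf.
pose K' := `|K| + 1.
have K'0 : 0 < K' by rewrite ltr_wpDl.
have {}cK i v : `|c i v| <= K' * `|v|.
  rewrite (le_trans (cK _ _))// ler_wpM2r// (le_trans (ler_norm K))//.
  by rewrite lerDl.
have dfE x v : 'D_v f x = \sum_i c i v * 'D_(e i) f x.
  rewrite [in LHS](ev v) deriveE// linear_sum; apply: eq_bigr => i _.
  by rewrite linearZ/= deriveE.
exists (fun v => 'D_v f a); split.
- by move=> k u v; rewrite !deriveE// linearP.
- exists (\sum_i K' * `|'D_(e i) f a|) => v.
  rewrite dfE (le_trans (ler_norm_sum _ _ _))// mulr_suml ler_sum// => i _.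
  by rewrite normrM mulrAC ler_wpM2r.
- move=> eps eps0.
  (* Each of the [#|I|] basis directions contributes at most [K' * d] times the norm of [y - z]; the
     successor keeps the divisor nonzero when [I] is empty. *)
  pose d := eps / (K' * #|I|.+1%:R).
  have d0 : 0 < d by rewrite divr_gt0// mulr_gt0.
  have : \forall x \near a, forall i, `|'D_(e i) f a - 'D_(e i) f x| < d.
    apply: filter_forall => i; move/cvgrPdist_lt : (cf (e i)); exact.
  move=> /nbhs_normP[r /= r0 fr].
  near=> y z.
  have ay : `|a - y| < r by near: y; apply/nbhs_normP; exists r.
  have az : `|a - z| < r by near: z; apply/nbhs_normP; exists r.
  have [t /andP[t0 t1] ->] := mean_value_segment y z.
  have ax : `|a - (t *: (y - z) + z)| < r.
    (* The intermediate point is a convex combination of [y] and [z], so it stays in the ball around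
       [a]. *)
    rewrite (_ : _ - _ = t *: (a - y) + (1 - t) *: (a - z)); last first.
      rewrite scalerBl scale1r addrCA -scalerBr.
      have -> : a - y - (a - z) = - (y - z) by rewrite !opprB addrC subrKA.
      by rewrite scalerN opprD addrCA addrC.
    rewrite (le_lt_trans (ler_normD _ _))// !normrZ (ger0_norm t0).
    rewrite ger0_norm ?subr_ge0//.
    pose m := Num.max `|a - y| `|a - z|.
    rewrite (@le_lt_trans _ _ (t * m + (1 - t) * m))//.
      by rewrite lerD// ler_wpM2l ?subr_ge0// le_max lexx ?orbT.
    by rewrite -mulrDl subrKC mul1r gt_max ay.
  rewrite !dfE -sumrB (le_trans (ler_norm_sum _ _ _))//.
  have H i : true -> `|c i (y - z) * 'D_(e i) f (t *: (y - z) + z)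
      - c i (y - z) * 'D_(e i) f a| <= K' * d * `|y - z|.
    move=> _; rewrite -mulrBr normrM mulrAC ler_pM//.
    by rewrite distrC ltW//; exact: fr.
  rewrite (le_trans (ler_sum _ H))// sumr_const -mulr_natl.
  have -> : eps * `|y - z| = #|I|.+1%:R * (K' * d * `|y - z|).
    by rewrite /d; field; rewrite nat1r pnatr_eq0/= gt_eqF.
  rewrite ler_wpM2r ?ler_nat ?leqW ?max_card//.
  by apply: mulr_ge0 => //; apply: mulr_ge0; exact: ltW.
Unshelve. all: by end_near. Qed.

End C1.

(** * Lipschitz localizations under restriction and perturbation of the parameter *)

Lemma ex_lipschitz_gt0 (R : realType) (A B : normedModType R) (U : set A)
    (phi : A -> B) :
  [lipschitz phi y | y in U] ->
  exists2 L, 0 < L & forall y y', U y -> U y' -> `|phi y - phi y'| <= L * `|y - y'|.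
Proof.
move=> lphi.
have [L [L0 lL]] := filter_ex (filterI (nbhs_pinfty_gt (num_real 0)) lphi).
by exists L => // y y' Uy Uy'; apply: (lL (y, y')).
Qed.

(** Freezing [w] slices the neighborhood and the localization; in the max norm [(q, w)] and
    [(q', w)] are as far apart as [q] and [q'], so the Lipschitz constant survives. *)
Lemma lipschitz_localization_section (R : realType) (Y W Z : normedModType R)
    (S : Y * W -> set Z) (y : Y) (w : W) (z : Z) :
  lipschitz_localization S (y, w) z ->
  lipschitz_localization (fun q => S (q, w)) y z.
Proof.
move=> [Sz [U [V [phi [nU nV phiV lphi gphi]]]]]; split=> //.
exists [set q | U (q, w)], V, (fun q => phi (q, w)); split=> //.
- case: nU => -[A B] /= [nA nB] ABU; apply: filterS nA => q Aq.
  by apply: (ABU (q, w)); split=> //; exact: nbhs_singleton.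
- by move=> q Uq; exact: phiV.
- move: lphi; rewrite /lipschitz_on; apply: filterS => L lL [q q'] [/= Uq Uq'].
  have := lL ((q, w), (q', w)) (conj Uq Uq').
  by rewrite /= [X in _ <= _ * X]prod_normE/= subrr normr0 max_l.
- apply/seteqP; split=> -[q z'] /= H.
    by have /seteqP[/(_ ((q, w), z')) + _] := gphi; apply.
  by have /seteqP[_ /(_ ((q, w), z'))] := gphi; apply.
Qed.

(** The contraction argument for an arbitrary set-valued [T] and a strictly differentiable [F], free
    of the KKT structure. *)
Lemma lipschitz_localization_perturb (R : realType) (Y W : normedModType R)
    (Z : completeNormedModType R) (T : Y -> set Z) (F : Z * W -> Y)
    (ybar : Y) (zbar : Z) (wbar : W) :
  strictly_differentiable F (zbar, wbar) ->
  lipschitz_localization T ybar zbar ->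
  lipschitz_localization
    (fun p : Y * W => [set z | T (p.1 + (F (z, wbar) - F (z, p.2))) z])
    (ybar, wbar) zbar.
Proof.
move=> sF [Tbar [U0 [V0 [phi [nU0 nV0 phiV /ex_lipschitz_gt0[L L0 lphi] gphT]]]]].
have phiT y z : U0 y -> V0 z -> T y z <-> z = phi y.
  move=> Uy Vz; have /seteqP[/(_ (y, z))/= gT /(_ (y, z))/= gp] := gphT.
  by split=> [Tyz|zy]; [have [] := gT (conj Tyz (conj Uy Vz))
                        |have [] := gp (conj Uy zy)].
have [K K0 FK] := strictly_differentiable_lipschitz sF.
(* With this accuracy [z |-> F (z, wbar) - F (z, w)] is [(2 * L)^-1]-Lipschitz, so
   its composition with the [L]-Lipschitz [phi] has contraction constant 1/2. *)
have c0 : 0 < (4 * L)^-1 by rewrite invr_gt0 mulr_gt0.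
have [l [_ _ /(_ _ c0) Fl]] := sF.
have [r1 r10 {FK Fl}Fr] := near2_ball (filterI FK Fl).
have [r2 /= r20 V0r] : exists2 r2, 0 < r2 & forall z, `|zbar - z| < r2 -> V0 z.
  by move/nbhs_normP : nV0 => [r2 ? ?]; exists r2.
have [s1 /= s10 U0s] : exists2 s1, 0 < s1 & forall y, `|ybar - y| < s1 -> U0 y.
  by move/nbhs_normP : nU0 => [s1 ? ?]; exists s1.
have U0bar : U0 ybar by apply: U0s; rewrite subrr normr0.
have V0bar : V0 zbar by apply: V0r; rewrite subrr normr0.
have phibar : phi ybar = zbar by apply/esym/phiT.
(* Halving puts the closed ball [B] of radius [r] inside the open balls of radii [r1] and [r2]. *)
pose r := Num.min r1 r2 / 2.
have r0 : 0 < r by rewrite divr_gt0// lt_min r10 r20.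
have [rr1 rr2] : r < r1 /\ r < r2.
  by apply/andP; rewrite -lt_min ltr_pdivrMr// ltr_pMr ?ltr1n// lt_min r10.
pose h z w := F (z, wbar) - F (z, w).
(* One [s] is the budget for the distance from [y] to [ybar], the other for the size of [h z w]:
   together they stay within [U0], and [phi] moves their sum by at most [r]. *)
pose s := Num.min s1 (r / L) / 2.
have s0 : 0 < s by rewrite divr_gt0// lt_min s10 divr_gt0.
have [ss1 ssL] : s + s <= s1 /\ L * (s + s) <= r.
  rewrite -splitr -ler_pdivlMl// [_^-1 * _]mulrC.
  by rewrite !ge_min !lexx orbT.
(* The first entry bounds [h z w] by [s], the second keeps [(z, w)] where the estimates on [F]
   hold. *)
pose d := Num.min (s / K) r1.
have d0 : 0 < d by rewrite !lt_min r10 divr_gt0.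
pose B := [set z | `|zbar - z| <= r].
pose D := [set w | `|wbar - w| < d].
have DK w : D w -> K * `|wbar - w| <= s.
  by rewrite /D /= lt_min => /andP[wK _]; rewrite -ler_pdivlMl// mulrC ltW.
have BD z w : B z -> D w -> `|(zbar, wbar) - (z, w)| < r1.
  rewrite /D /= lt_min => zr /andP[_ w1]; rewrite prod_normE gt_max/= w1 andbT.
  exact: le_lt_trans zr rr1.
have hw z w w' : B z -> D w -> D w' -> `|h z w - h z w'| <= K * `|w - w'|.
  move=> Bz Dw Dw'; have [/= + _] := Fr _ _ (BD _ _ Bz Dw) (BD _ _ Bz Dw').
  rewrite (_ : h z w - _ = F (z, w') - F (z, w)); last first.
    by rewrite /h opprB addrC subrKA.
  rewrite distrC => /le_trans; apply.
  by rewrite prod_normE/= subrr normr0 max_r.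
have Dbar : D wbar by rewrite /D/= subrr normr0.
have h0 z : h z wbar = 0 by rewrite /h subrr.
have hs z w : B z -> D w -> `|h z w| <= s.
  move=> Bz Dw; rewrite -normrN -[- _]add0r -(h0 z) (le_trans (hw _ _ _ _ _ _))//.
  exact: DK.
have hz z z' w : B z -> B z' -> D w -> `|h z w - h z' w| <= (2 * L)^-1 * `|z - z'|.
  move=> Bz Bz' Dw.
  (* For [v = wbar] and [v = w] the linear part is the same [l (z - z', 0)], so it cancels in
     [h z w - h z' w]; only two remainders are left. *)
  have Flw v : D v -> `|F (z, v) - F (z', v) - l (z - z', 0)| <= (4 * L)^-1 * `|z - z'|.
    move=> Dv; have [/= _] := Fr _ _ (BD _ _ Bz Dv) (BD _ _ Bz' Dv).
    rewrite (_ : (z, v) - _ = (z - z', 0)); last by congr pair; rewrite subrr.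
    by rewrite prod_normE/= normr0 max_l.
  rewrite (_ : h z w - _ = (F (z, wbar) - F (z', wbar) - l (z - z', 0))
                        - (F (z, w) - F (z', w) - l (z - z', 0))).
    rewrite (le_trans (ler_normB _ _))// (le_trans (lerD (Flw _ _) (Flw _ _)))//.
    rewrite -mulrDl ler_wpM2r// le_eqVlt; apply/orP; left; apply/eqP.
    by field; rewrite gt_eqF.
  rewrite [in RHS]opprB subrKA /h !opprB [LHS]addrACA [RHS]addrACA.
  by rewrite (addrC (- F (z, w))).
pose E := [set y | `|ybar - y| < s].
have EU y z w : E y -> B z -> D w -> U0 (y + h z w).
  move=> Ey Bz Dw; apply: U0s; rewrite opprD addrA (lt_le_trans _ ss1)//.
  by rewrite (le_lt_trans (ler_normB _ _))// ltr_leD// hs.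
pose g y w z := phi (y + h z w).
have gB y w : E y -> D w -> set_fun B B (g y w).
  move=> Ey Dw z Bz; rewrite /B /= /g -phibar (le_trans (lphi _ _ _ _))//.
    exact: EU.
  rewrite (le_trans _ ssL)// ler_pM2l// opprD addrA.
  by rewrite (le_trans (ler_normB _ _))// lerD ?hs// ltW.
have glip y w z z' : E y -> D w -> B z -> B z' ->
    `|g y w z - g y w z'| <= 2^-1 * `|z - z'|.
  move=> Ey Dw Bz Bz'; rewrite (le_trans (lphi _ _ (EU _ _ _ _ _ _) (EU _ _ _ _ _ _)))//.
  rewrite opprD addrACA subrr add0r -ler_pdivlMl// mulrA -invfM (mulrC L).
  exact: hz.
have clB : closed B.
  have -> : B = closed_ball_ Num.norm zbar r by [].
  by rewrite -closed_ballE//; exact: closed_ball_closed.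
have Bbar : B zbar by rewrite /B/= subrr normr0 ltW.
have fixg y w : E y -> D w -> exists2 z, B z & z = g y w z.
  move=> Ey Dw.
  pose G := HB.pack_for {fun B >-> B} (g y w) (isFun.Build _ _ _ _ _ (gB _ _ Ey Dw)).
  apply: (@banach_fixed_point _ _ B G) => //; last by exists zbar.
  exists (2^-1%:nng); split => /=; first by rewrite invf_lt1// ltr1n.
  by move=> [z z'] [Bz Bz']; exact: glip.
(* With [n] the parameter distance, the estimates give $|z-z'| \le L(1+K)n + |z-z'|/2$, and the last
   term is absorbed on the left. Equal parameters give uniqueness of the fixed point. *)
have fixg_lip y w z y' w' z' : E y -> D w -> B z -> E y' -> D w' -> B z' ->
    z = g y w z -> z' = g y' w' z' ->
    `|z - z'| <= 2 * L * (1 + K) * `|(y, w) - (y', w')|.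
  move=> Ey Dw Bz Ey' Dw' Bz' zg zg'.
  have := lphi _ _ (EU _ _ _ Ey Bz Dw) (EU _ _ _ Ey' Bz' Dw').
  rewrite -/(g _ _ _) -/(g _ _ _) -zg -zg'; set n := `|(y, w) - (y', w')|.
  have yn : `|y - y'| <= n by rewrite /n prod_normE/= le_max lexx.
  have wn : `|w - w'| <= n by rewrite /n prod_normE/= le_max lexx orbT.
  have : `|y + h z w - (y' + h z' w')| <= n + ((2 * L)^-1 * `|z - z'| + K * n).
    rewrite opprD addrACA (le_trans (ler_normD _ _))// lerD//.
    rewrite -(subrKA (h z' w)) (le_trans (ler_normD _ _))// lerD ?hz//.
    by rewrite (le_trans (hw _ _ _ _ _ _))// ler_pM2l.
  rewrite -(ler_pM2l L0) => /[swap] /le_trans /[apply].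
  have -> : L * (n + ((2 * L)^-1 * `|z - z'| + K * n)) =
            L * (1 + K) * n + 2^-1 * `|z - z'|.
    by field; rewrite gt_eqF.
  lra.
(* [psi] picks the fixed point on [E] times [D] and takes the default value 0 elsewhere. *)
have /choice[psi psiP] : forall p : Y * W,
    exists z, E p.1 -> D p.2 -> B z /\ z = g p.1 p.2 z.
  move=> [y w]; have [[Ey Dw]|nED] := pselect (E y /\ D w).
    by have [z Bz zg] := fixg _ _ Ey Dw; exists z.
  by exists 0 => Ey Dw; case: nED.
have Ebar : E ybar by rewrite /E/= subrr normr0.
have TgP y w z : E y -> D w -> B z -> T (y + h z w) z <-> z = g y w z.
  by move=> Ey Dw Bz; apply: phiT; [exact: EU|apply: V0r; exact: le_lt_trans Bz rr2].
split=> /=; first by rewrite subrr addr0.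
exists (E `*` D), B, psi; split.
- by exists (E, D) => //=; split; apply/nbhs_normP; [exists s|exists d].
- by apply/nbhs_normP; exists r => // z; exact: ltW.
- by move=> [y w] [/= Ey Dw]; have [] := psiP (y, w) Ey Dw.
- have PF : ProperFilter (globally ((E `*` D) `*` (E `*` D))).
    by apply: (@globally_properfilter _ _ ((ybar, wbar), (ybar, wbar))).
  apply: (@klipschitzW _ _ _ (2 * L * (1 + K)) psi) => -[[y w] [y' w']].
  move=> [[/= Ey Dw] [/= Ey' Dw']] /=.
  have [] := psiP (y, w) Ey Dw; have [] := psiP (y', w') Ey' Dw' => /=.
  by move=> *; exact: fixg_lip.
- apply/seteqP; split=> [[[y w] z] /= [Tz [[Ey Dw] Bz]]|[[y w] z] /= [[Ey Dw] ->]].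
    have [/= Bpsi psig] := psiP (y, w) Ey Dw.
    (* Uniqueness: [z] and [psi (y, w)] are fixed points for the same parameters, so [fixg_lip]
       bounds their distance by 0. *)
    split=> //; apply/eqP; rewrite -subr_eq0 -normr_le0.
    have /(TgP _ _ _ Ey Dw Bz) zg := Tz.
    by have := fixg_lip _ _ _ _ _ _ Ey Dw Bz Ey Dw Bpsi zg psig;
       rewrite subrr normr0 mulr0.
  have [/= Bpsi psig] := psiP (y, w) Ey Dw.
  by split=> //; apply/TgP.
Qed.

(** * Strict differentiability of projections, block maps and $C^1$ functions on products of row
    spaces *)

Section Coordinates.
Variable R : realType.
Implicit Types V W : normedModType R.

Lemma strictly_differentiable_fst V W (a : V * W) : strictly_differentiable fst a.
Proof.
apply: strictly_differentiable_linear; first by move=> k u v.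
by exists 1 => v; rewrite mul1r prod_normE le_max lexx.
Qed.

Lemma strictly_differentiable_snd V W (a : V * W) : strictly_differentiable snd a.
Proof.
apply: strictly_differentiable_linear; first by move=> k u v.
by exists 1 => v; rewrite mul1r prod_normE le_max lexx orbT.
Qed.

Lemma strictly_differentiable_coord n (i : 'I_n) (a : 'rV[R]_n) :
  strictly_differentiable (fun v : 'rV_n => v 0 i) a.
Proof.
apply: strictly_differentiable_linear; first by move=> k u v; rewrite !mxE.
by exists 1 => v; rewrite mul1r le_rV_norm.
Qed.

Lemma strictly_differentiable_submxrow N (n : 'I_N -> nat) k (a : blockvec R n) :
  strictly_differentiable (fun v : blockvec R n => submxrow v k) a.
Proof.
apply: strictly_differentiable_row => j.
have -> : (fun v : blockvec R n => submxrow v k 0 j) =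
    (fun v => v 0 (tagnat.Rank k j)) by apply/funext => v; rewrite mxE.
exact: strictly_differentiable_coord.
Qed.

Lemma strictly_differentiable_mxrow V N (n : 'I_N -> nat)
    (f : forall k, V -> 'rV[R]_(n k)) a :
  (forall k, strictly_differentiable (f k) a) ->
  strictly_differentiable (fun x => \mxrow_k f k x) a.
Proof.
move=> sf; apply: strictly_differentiable_row => j.
have -> : (fun x => (\mxrow_k f k x) 0 j) =
    (fun x => f (tagnat.sig1 j) x 0 (tagnat.sig2 j)) by apply/funext => x; rewrite mxE.
exact: strictly_differentiable_comp (strictly_differentiable_coord _ _) (sf _).
Qed.

Lemma Cr1_strictly_differentiable m n (f : 'rV[R]_m * 'rV[R]_n -> R) a :
  Cr 1 f -> strictly_differentiable f a.
Proof.
move=> [df cf].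
apply: (@C1_strictly_differentiable _ _ _ df ('I_m + 'I_n)%type
  (* The standard basis of the product; in the max norm its coordinate functions are bounded with
     constant 1. *)
  (fun s => match s with inl i => (delta_mx 0 i, 0) | inr j => (0, delta_mx 0 j) end)
  (fun s v => match s with inl i => v.1 0 i | inr j => v.2 0 j end) 1).
- move=> [x y]; rewrite big_sumType/=.
  have -> : \sum_i x 0 i *: (delta_mx 0 i : 'rV_m, 0 : 'rV[R]_n) = (x, 0).
    rewrite [in RHS](row_sum_delta x)
      (big_morph (fun u => (u, 0)) (id1 := 0) (op1 := +%R))//.
      by apply: eq_bigr => i _; congr pair; rewrite /= scaler0.
    by move=> u v; congr pair; rewrite /= addr0.
  have -> : \sum_j y 0 j *: (0 : 'rV[R]_m, delta_mx 0 j : 'rV_n) = (0, y).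
    rewrite [in RHS](row_sum_delta y)
      (big_morph (fun u => (0, u)) (id1 := 0) (op1 := +%R))//.
      by apply: eq_bigr => j _; congr pair; rewrite /= scaler0.
    by move=> u v; congr pair; rewrite /= addr0.
  by congr pair; rewrite /= ?addr0 ?add0r.
- move=> [i|j] v; rewrite mul1r (le_trans (le_rV_norm _ _))// prod_normE le_max lexx//.
  by rewrite orbT.
- by move=> v; exact: cf.
Qed.

Lemma Cr_le V r (f : V -> R) : Cr r.+1 f -> Cr r f.
Proof.
elim: r f => [|r IH] f [df cf].
  by move=> x; apply: differentiable_continuous.
by split=> // v; exact: IH.
Qed.

End Coordinates.

(** * The map $F$ of constraint values and Lagrangian gradients *)

Section KKTmap.
Variables (R : realType) (P : nep R).

Local Notation point :=
  (blockvec R (xdim P) * blockvec R (cdim P) * blockvec R (wdim P))%type.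

Definition KKT_constraint (z : blockvec R (xdim P) * blockvec R (cdim P))
    (w : blockvec R (wdim P)) : blockvec R (cdim P) :=
  \mxrow_k \row_i constraint P k i (submxrow z.1 k, submxrow w k).

Definition KKT_gradient (z : blockvec R (xdim P) * blockvec R (cdim P))
    (w : blockvec R (wdim P)) : blockvec R (xdim P) :=
  \mxrow_k gradient
    (fun y => Lagrangian (setblock z.1 k y) (submxrow z.2 k) (submxrow w k))
    (submxrow z.1 k).

Lemma setblockK (N : nat) (n : 'I_N -> nat) (x : blockvec R n) k (y : 'rV[R]_(n k)) :
  submxrow (setblock x k y) k = y.
Proof. by rewrite mxrowK dfwith_in. Qed.

Lemma setblock_submxrow (N : nat) (n : 'I_N -> nat) (x : blockvec R n) k :
  setblock x k (submxrow x k) = x.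
Proof.
apply/mxrowP => j; rewrite mxrowK.
by case: dfwithP.
Qed.

(** Moving block [k] along [v] moves the whole vector along [setblock 0 k v], the embedding of [v]
    with zeros in the other blocks. *)
Lemma setblock_affine (N : nat) (n : 'I_N -> nat) (x : blockvec R n) k
    (y v : 'rV[R]_(n k)) (h : R) :
  setblock x k (h *: v + y) = h *: setblock 0 k v + setblock x k y.
Proof.
apply/mxrowP => j; rewrite submxrowD.
have -> : submxrow (h *: setblock 0 k v) j = h *: submxrow (setblock 0 k v) j.
  by apply/rowP => i; rewrite !mxE.
rewrite !mxrowK; case: (eqVneq k j) => [kj|kj].
  by case: _ / kj; rewrite !dfwith_in.
by rewrite !dfwith_out// submxrow0 scaler0 add0r.
Qed.

(** Rewrites the partial gradient through directional derivatives of the objective and constraints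
    on their full domains, which exposes its joint dependence on [x], [lam] and [w]. *)
Lemma gradient_Lagrangian (k : 'I_(players P)) (x : blockvec R (xdim P))
    (lam : 'rV[R]_(cdim P k)) (w : 'rV[R]_(wdim P k)) j :
  gradient (fun y => Lagrangian (setblock x k y) lam w) (submxrow x k) 0 j =
  'D_(setblock 0 k (delta_mx 0 j), 0) (objective P k) (x, w) +
  \sum_i lam 0 i * 'D_(delta_mx 0 j, 0) (constraint P k i) (submxrow x k, w).
Proof.
rewrite mxE.
pose A y : blockvec R (xdim P) * 'rV[R]_(wdim P k) := (setblock x k y, w).
pose B y : 'rV[R]_(xdim P k) * 'rV[R]_(wdim P k) := (y, w).
have Aaff (h : R) : A (h *: delta_mx 0 j + submxrow x k) =
    h *: (setblock 0 k (delta_mx 0 j), 0) + A (submxrow x k).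
  by rewrite /A setblock_affine; congr pair; rewrite /= scaler0 add0r.
have Baff (h : R) : B (h *: delta_mx 0 j + submxrow x k) =
    h *: (delta_mx 0 j, 0) + B (submxrow x k).
  by congr pair; rewrite /= scaler0 add0r.
have [df _] := @objective_C2 _ P k.
have dg i : forall y, differentiable (constraint P k i) y.
  by have [] := @constraint_C2 _ P k i.
have dgB i : derivable (constraint P k i \o B) (submxrow x k) (delta_mx 0 j).
  exact: derivable_comp_affine Baff (diff_derivable _).
rewrite (_ : (fun y => _) = (objective P k \o A) +
    \sum_i (lam 0 i \*: (constraint P k i \o B))); last first.
  by apply/funext => y; rewrite /Lagrangian setblockK /= fct_sumE.
rewrite deriveD.
- rewrite (derive_comp_affine _ Aaff) derive_sum.
  + rewrite /A setblock_submxrow; congr (_ + _); apply: eq_bigr => i _.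
    by rewrite deriveZ// (derive_comp_affine _ Baff).
  + by move=> i; apply: derivableZ.
- by apply: derivable_comp_affine Aaff (diff_derivable _).
- by apply: derivable_sum => i; apply: derivableZ.
Qed.

Definition KKT_map z := (KKT_constraint z.1 z.2, KKT_gradient z.1 z.2).

(** Directional derivatives of $C^2$ functions are $C^1$, hence strictly differentiable; the
    multipliers enter through the product rule. *)
Lemma KKT_map_strictly_differentiable z : strictly_differentiable KKT_map z.
Proof.
have sx : strictly_differentiable (fun z : point => z.1.1) z.
  apply: strictly_differentiable_comp; exact: strictly_differentiable_fst.
have sl : strictly_differentiable (fun z : point => z.1.2) z.
  apply: strictly_differentiable_comp (strictly_differentiable_fst _).
  exact: strictly_differentiable_snd.
have sw k : strictly_differentiable (fun z : point => submxrow z.2 k) z.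
  apply: strictly_differentiable_comp (strictly_differentiable_snd _).
  exact: strictly_differentiable_submxrow.
have sxw k :
    strictly_differentiable (fun z : point => (submxrow z.1.1 k, submxrow z.2 k)) z.
  apply: strictly_differentiable_pair (sw k).
  exact: strictly_differentiable_comp (strictly_differentiable_submxrow _ _) sx.
apply: strictly_differentiable_pair; apply: strictly_differentiable_mxrow => k;
  apply: strictly_differentiable_row => j.
  rewrite (_ : (fun x => _) = (fun x =>
      constraint P k j (submxrow x.1.1 k, submxrow x.2 k))); last first.
    by apply/funext => x; rewrite mxE.
  apply: strictly_differentiable_comp (sxw k); apply: Cr1_strictly_differentiable.
  exact/Cr_le/constraint_C2.
rewrite (_ : (fun x => _) = (fun x =>
    'D_(setblock 0 k (delta_mx 0 j), 0) (objective P k) (x.1.1, submxrow x.2 k) +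
    \sum_i submxrow x.1.2 k 0 i *
      'D_(delta_mx 0 j, 0) (constraint P k i) (submxrow x.1.1 k, submxrow x.2 k)));
  last by apply/funext => x; exact: gradient_Lagrangian.
apply: strictly_differentiableD.
  have [_ Df] := @objective_C2 _ P k.
  have sxwk : strictly_differentiable (fun z : point => (z.1.1, submxrow z.2 k)) z.
    exact: strictly_differentiable_pair sx (sw k).
  exact: strictly_differentiable_comp (Cr1_strictly_differentiable _ (Df _)) sxwk.
apply: strictly_differentiable_sum => i; apply: strictly_differentiableM.
  apply: strictly_differentiable_comp (strictly_differentiable_coord _ _) _.
  exact: strictly_differentiable_comp (strictly_differentiable_submxrow _ _) sl.
have [_ Dg] := @constraint_C2 _ P k i.
exact: strictly_differentiable_comp (Cr1_strictly_differentiable _ (Dg _)) (sxw k).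
Qed.

(** The shift changes [u] exactly as much as the constraint values and [v] as much as the gradient,
    so slacks, complementarity and stationarity persist. *)
Lemma S_KKT_shift q w w' z :
  S_KKT P (q, w) z ->
  S_KKT P (q + (KKT_map (z, w') - KKT_map (z, w)), w') z.
Proof.
case: q z => [u v] [x lam] Sz k; have /= [vk gE gI] := Sz k.
have dgE i : submxrow (u + (KKT_constraint (x, lam) w' - KKT_constraint (x, lam) w)) k 0 i
    = submxrow u k 0 i + (constraint P k i (submxrow x k, submxrow w' k)
                         - constraint P k i (submxrow x k, submxrow w k)).
  by rewrite submxrowD submxrowB !mxrowK !mxE.
split.
- by rewrite submxrowD submxrowB !mxrowK vk subrKC.
- by move=> i ik; rewrite dgE -gE// subrKC.
- move=> i ki; have [lam0 gu lamg] := gI i ki; rewrite dgE; split=> //.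
    by lra.
  by rewrite -[RHS]lamg; congr (_ * _); ring.
Qed.

End KKTmap.

Theorem corollary3p1 (R : realType) (P : nep R)
    (ubar : blockvec R (cdim P)) (vbar : blockvec R (xdim P))
    (wbar : blockvec R (wdim P))
    (xbar : blockvec R (xdim P)) (lambar : blockvec R (cdim P)) :
  S_KKT P (ubar, vbar, wbar) (xbar, lambar) ->
  (lipschitz_localization (S_KKT P) (ubar, vbar, wbar) (xbar, lambar) <->
   lipschitz_localization (T_KKT P wbar) (ubar, vbar) (xbar, lambar)).
Proof.
have TE : (fun q => S_KKT P (q, wbar)) = T_KKT P wbar by apply/funext => -[].
move=> Sbar; split=> [/lipschitz_localization_section|]; first by rewrite TE.
move=> /(lipschitz_localization_perturb
  (KKT_map_strictly_differentiable (xbar, lambar, wbar))).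
(* It remains to identify the perturbed [T_KKT] with [S_KKT]: shifting from [wbar] back to [w]
   cancels the perturbation, and shifting from [w] to [wbar] creates it. *)
rewrite (_ : (fun p => _) = S_KKT P)//.
apply/funext => -[q w]; apply/seteqP; split=> z /=.
  move=> /(@S_KKT_shift _ P (q + (KKT_map (z, wbar) - KKT_map (z, w))) wbar w z).
  by rewrite -addrA subrKA subrr addr0.
by move=> /(S_KKT_shift wbar); case: q.
Qed.
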